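(* Let $(B_t)_{t\ge0}$ be the Brownian motion on an admissible Riemannian polyhedron $K$. Then $(B_t)_{t\ge0}$ has an infinitesimal generator $L$ defined on a Banach subspace $\mathbf D_L$, i.e. for every $f\in\mathbf D_L$ the limit $$Lf:=\lim_{t\to0}\frac{E[f(B_t)]-f(B_0)}{t}$$ exists uniformly (with respect to the starting point $B_0\in K$).
   Context: **Polyhedra.** A polyhedron is a connected locally compact separable Hausdorff space $K$ with a homeomorphism $\theta:C\to K$ from a simplicial complex $C$ (a triangulation; $C$ is then countable and locally finite). Simplexes and skeletons of $K$ are images under $\theta$ of those of $C$; $K^{(s)}$ denotes the $s$-skeleton. $K$ is a Lip polyhedron if $\theta$ is locally bi-Lipschitz. An $n$-dimensional Riemannian polyhedron $(K,g)$ is a Lip polyhedron of homogeneous dimension $n$ with specified triangulation in which each maximal simplex $S$ carries a (piecewise smooth) Riemannian metric $g_S$ satisfying, in Euclidean coordinates, $\Lambda_S^{-2}|\xi|^2\le \sum g^S_{ij}(x)\xi^i\xi^j\le\Lambda_S^2|\xi|^2$ for some $\Lambda_S>0$, continuous up to the boundary, the metrics being compatible on common faces ($(g_S)_{|S'}=g_{S'}$ for $S'\subset S$). It is admissible if it is dimensionally homogeneous and $U\setminus K^{(n-2)}$ is connected for every connected open $U\subset K$. **Brownian motion.** For $p\in K$ the link $\mathfrak U_p$ is the set of unit tangent vectors at $p$ pointing into the $n$-simplexes containing $p$, with its volume measure as a spherical polyhedron. For a tangent vector $v$, $\Upsilon_v$ denotes the generalized geodesic flow: the trajectory with initial velocity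 $v$ which is geodesic of constant speed in each $n$-simplex and, on reaching an interior point of an $(n-1)$-simplex, continues geodesically into one of the other adjacent $n$-simplexes, chosen with equal probabilities (in the direction at distance $\pi$ in the link from the reversed incoming direction). For $\eta\in(0,1]$ let $Y^\eta_t=\Upsilon_{\eta Z_i}(t/\eta^2-\tau_i)$ for $\tau_i\le t/\eta^2\le\tau_{i+1}$, where $\tau_0=0$, the increments $\tau_{i+1}-\tau_i$ are independent, identically exponentially distributed, and $Z_i$ is chosen at random, with respect to the normalized volume measure, in the link of the current point at time $\tau_i$ ($Y^\eta$ being sent to the added point of the one-point compactification of $K$ after its lifetime). The laws $\mu_\eta$ of $Y^\eta$ on $\mathcal C(\mathbb R^+,K)$ have a weakly convergent subsequence as $\eta\to0$; the limit $W$ (Wiener measure) defines the Brownian motion $(B_t)$ in $K$, a Markov process with continuous paths. The exponential parameter is normalized according to the convention that Brownian motion on a Riemannian manifold is generated by $\frac12\Delta$. The infinitesimal generator is meant in Dynkin's sense: functions on $K$ are considered with the supremum norm, and $\mathbf D_L$ is the space of functions $f$ for which the limit $\lim_{t\to0}\frac{E[f(B_t)]-f(B_0)}{t}$ exists uniformly with respect to the starting point $B_0\in K$.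
   Formalization: ''Banach subspace'' is taken as: D_L is a linear space of bounded Borel functions, complete for the graph norm sup|f| + sup|Lf|; completeness for the supremum norm is false (on the flat circle D_L = C^2, not closed under uniform convergence). *)

(* Defs.v *)
From HB Require Import structures.
From mathcomp Require Import all_boot all_order all_algebra finmap.
From mathcomp Require Import all_classical all_reals all_analysis.

Set Implicit Arguments.
Unset Strict Implicit.
Unset Printing Implicit Defensive.

Import Order.TTheory GRing.Theory Num.Theory.
Import numFieldNormedType.Exports.

Local Open Scope classical_set_scope.
Local Open Scope ring_scope.

Definition borel (T : topologicalType) : set (set T) := <<s [set A | open A] >>.

Definition borel_fun (T U : topologicalType) (f : T -> U) : Prop :=
  forall A : set U, open A -> borel (f @^-1` A).

Definition box_volume (R : realType) (n : nat) (a b : 'rV[R]_n) : R :=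
  \prod_(i < n) Num.max 0 (b 0 i - a 0 i).

(** The outer measure, which is the Lebesgue measure on Borel sets. *)
Definition lebesgue_rV (R : realType) (n : nat) (A : set 'rV[R]_n) : \bar R :=
  ereal_inf [set s | exists a b : nat -> 'rV[R]_n,
    A `<=` \bigcup_k [set x | forall i, a k 0 i <= x 0 i <= b k 0 i] /\
    s = (\sum_(0 <= k <oo) (box_volume (a k) (b k))%:E)%E].

Record is_simplicial_complex (V : choiceType) (C : set {fset V}) : Prop := {
  simplex_neq0 : forall S, C S -> (S != fset0)%fset ;
  simplex_face : forall S F, C S -> (F `<=` S)%fset -> (F != fset0)%fset -> C F ;
  simplex_vertex : forall v, C [fset v]%fset ;
  simplex_locally_finite : forall v, finite_set [set S | C S /\ v \in S] }.

(** Points of a complex are given by their barycentric coordinates. *)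
Section Realization.
Variables (R : realType) (V : choiceType).
Implicit Types (S : {fset V}) (C : set {fset V}) (x y : V -> R).

Definition simplex S : set (V -> R) :=
  [set x | [/\ forall v, 0 <= x v, forall v, v \notin S -> x v = 0
             & \sum_(v <- S) x v = 1]].

Definition open_simplex S : set (V -> R) :=
  [set x | simplex S x /\ forall v, v \in S -> 0 < x v].

Definition realization C : set (V -> R) :=
  [set x | exists2 S, C S & simplex S x].

(** Euclidean distance; the sum has finite support on the realization. *)
Definition bary_dist x y : R :=
  Num.sqrt (\sum_(v \in [set: V]) (x v - y v) ^+ 2).

(** Affine coordinates on an [n]-simplex with (enumerated) vertices
    [v_0, ..., v_n]: the point with coordinates [x_1, ..., x_n] has barycentric
    coordinates [1 - sum x_i, x_1, ..., x_n].  The vertex [v_i] has index [i] in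
    [S], and vertices outside [S] get [0] as their index is [n + 1]. *)
Definition chart (n : nat) S (x : 'rV[R]_n) : V -> R := fun v =>
  if index v (enum_fset S) == 0 then 1 - \sum_(i < n) x 0 i
  else \sum_(i < n | i.+1 == index v (enum_fset S)) x 0 i.

Definition dchart (n : nat) S (xi : 'rV[R]_n) : V -> R := fun v =>
  if index v (enum_fset S) == 0 then - \sum_(i < n) xi 0 i
  else \sum_(i < n | i.+1 == index v (enum_fset S)) xi 0 i.

End Realization.

Definition std_simplex (R : realType) (n : nat) : set 'rV[R]_n :=
  [set x | (forall i, 0 <= x 0 i) /\ \sum_(i < n) x 0 i <= 1].

Definition std_open_simplex (R : realType) (n : nat) : set 'rV[R]_n :=
  [set x | (forall i, 0 < x 0 i) /\ \sum_(i < n) x 0 i < 1].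

(** The neighbourhood condition says that [theta] is a homeomorphism. *)
Record lip_polyhedron (R : realType) := LipPolyhedron {
  space :> metricType R ;
  vertex : choiceType ;
  cplx : set {fset vertex} ;
  theta : (vertex -> R) -> space ;
  cplxP : is_simplicial_complex cplx ;
  space_connected : connected [set: space] ;
  space_locally_compact : locally_compact [set: space] ;
  space_separable : exists2 D : set space, countable D & dense D ;
  space_hausdorff : hausdorff_space space ;
  theta_bij : set_bij (realization cplx) [set: space] theta ;
  theta_homeo : forall x, realization cplx x -> forall A : set space,
    nbhs (theta x) A <-> exists2 r : R, 0 < r &
      forall y, realization cplx y -> bary_dist x y < r -> A (theta y) ;
  theta_bilip : forall x, realization cplx x ->
    exists r l : R, [/\ 0 < r, 0 < l &
      forall y z, realization cplx y -> realization cplx z ->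
        bary_dist x y < r -> bary_dist x z < r ->
        l^-1 * bary_dist y z <= mdist (theta y) (theta z) <= l * bary_dist y z] }.

(** [C^oo] on an open set: all iterated directional derivatives exist and are
    Frechet differentiable there. *)
Definition smooth_on (R : realType) (n : nat) (U : set 'rV[R]_n)
    (f : 'rV[R]_n -> R) : Prop :=
  forall (vs : seq 'rV[R]_n) x, U x ->
    differentiable (foldr (fun v (h : 'rV[R]_n -> R) => fun y => 'D_v h y) f vs) x.

Definition bilin (R : realType) (n : nat) (G : 'M[R]_n) (xi zeta : 'rV[R]_n) : R :=
  (xi *m G *m zeta^T) 0 0.

Definition top_simplex (R : realType) (K : lip_polyhedron R) (n : nat) :
    set {fset vertex K} := [set S | cplx S /\ #|` S|%fset = n.+1].

Definition dim_homogeneous (R : realType) (K : lip_polyhedron R) (n : nat) : Prop :=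
  forall S : {fset vertex K}, cplx S -> exists2 S', top_simplex n S' & (S `<=` S')%fset.

(** [gram S x] is the matrix [g^S_ij(x)] in the affine coordinates of the
    maximal simplex [S].  Passing to another Euclidean structure on [S] is an
    affine change of coordinates, which only changes the ellipticity constant.
    In [gram_compatible], [xi1] and [xi2] represent the same vector, which is then
    tangent to the common face of [S1] and [S2]. *)
Record riem_polyhedron (R : realType) := RiemPolyhedron {
  lip :> lip_polyhedron R ;
  dim : nat ;
  lip_homogeneous : dim_homogeneous lip dim ;
  gram : {fset vertex lip} -> 'rV[R]_dim -> 'M[R]_dim ;
  gram_sym : forall S x, top_simplex dim S -> std_simplex x ->
    (gram S x)^T = gram S x ;
  gram_elliptic : forall S, top_simplex dim S -> exists2 Lambda : R, 0 < Lambda &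
    forall x xi : 'rV[R]_dim, std_simplex x ->
      Lambda ^- 2 * (\sum_i xi 0 i ^+ 2) <= bilin (gram S x) xi xi
        <= Lambda ^+ 2 * (\sum_i xi 0 i ^+ 2) ;
  gram_smooth : forall S i j, top_simplex dim S ->
    smooth_on (@std_open_simplex R dim) (fun x => gram S x i j) ;
  gram_continuous : forall S, top_simplex dim S ->
    {within @std_simplex R dim, continuous (gram S)} ;
  gram_compatible : forall S1 S2 x1 x2 xi1 xi2,
    top_simplex dim S1 -> top_simplex dim S2 ->
    std_simplex x1 -> std_simplex x2 ->
    chart S1 x1 = chart S2 x2 -> dchart S1 xi1 = dchart S2 xi2 ->
    bilin (gram S1 x1) xi1 xi1 = bilin (gram S2 x2) xi2 xi2 }.

(** [skeleton K m] is [K^(m-1)], the union of the simplexes with at most [m]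
    vertices; thus [K^(n-2)] is [skeleton K n.-1], empty for [n <= 1]. *)
Definition skeleton (R : realType) (K : lip_polyhedron R) (m : nat) : set K :=
  [set p | exists S : {fset vertex K}, [/\ cplx S, (#|` S|%fset <= m)%N
                                         & ((@theta R K) @` simplex S) p]].
Arguments skeleton {R} K m.

Definition admissible (R : realType) (K : riem_polyhedron R) : Prop :=
  dim_homogeneous K (dim K) /\
  forall U : set K, open U -> connected U ->
    connected (U `\` skeleton K (dim K).-1).

Section Flow.
Variables (R : realType) (K : riem_polyhedron R).
Local Notation V := (vertex K).
Local Notation n := (dim K).
Local Notation opc := (one_point_compactification K).
Implicit Types (S F : {fset V}) (x v w xi : 'rV[R]_n) (p : K).

Definition gnorm S x xi : R := Num.sqrt (bilin (gram S x) xi xi).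

Definition unit_dir S x xi : 'rV[R]_n := (gnorm S x xi)^-1 *: xi.

Definition in_top_simplex S p : Prop :=
  top_simplex n S /\ (@theta R K @` simplex S) p.

Definition coord S p : 'rV[R]_n :=
  xget 0 [set x | std_simplex x /\ theta (chart S x) = p].

Definition inward x xi : Prop :=
  exists2 e : R, 0 < e & std_simplex (x + e *: xi).

(** Volume, in the part of the link of [p] lying in the top simplex [S], of the
    set of directions [A]: the spherical volume for the inner product [g_S(p)]
    is [n] times the volume of the cone of radius one. *)
Definition link_volume p S (A : set 'rV[R]_n) : R :=
  if `[< in_top_simplex S p >] then
    let x := coord S p in
    n%:R * Num.sqrt (\det (gram S x)) *
      fine (lebesgue_rV [set xi | [/\ 0 < gnorm S x xi <= 1, inward x xi
                                    & A (unit_dir S x xi)]])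
  else 0.

(** Normalized volume measure of the link of [p]; a direction is a pair made of
    a top simplex and a unit vector in its coordinates.  Nothing is sampled at
    the added point. *)
Definition link_law (q : opc) S (A : set 'rV[R]_n) : R :=
  if q is Some p then
    link_volume p S A / \sum_(S' \in [set: {fset V}]) link_volume p S' setT
  else 0.

Definition christoffel S x (k i j : 'I_n) : R :=
  let D (l : 'I_n) (a b : 'I_n) : R := 'D_(delta_mx 0 l) (fun y => gram S y a b) x in
  2^-1 * \sum_l invmx (gram S x) k l * (D i j l + D j i l - D l i j).

Definition geodesic_at S (c : R -> 'rV[R]_n) (t : R) : Prop :=
  [/\ std_open_simplex (c t), derivable c t 1, derivable (derive1 c) t 1 &
    forall k : 'I_n, derive1 (derive1 c) t 0 k +
      \sum_i \sum_j christoffel S (c t) k i j * derive1 c t 0 i * derive1 c t 0 j = 0].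

Definition velocity_right (c : R -> 'rV[R]_n) (t : R) v : Prop :=
  h^-1 *: (c (t + h) - c t) @[h --> 0^'+] --> v.

Definition velocity_left (c : R -> 'rV[R]_n) (t : R) v : Prop :=
  h^-1 *: (c (t + h) - c t) @[h --> 0^'-] --> v.

(** Distance, in the link of an interior point of an [(n-1)]-simplex [F], between
    unit vectors [w1], [w2] pointing into two distinct top simplexes [S1], [S2]
    adjacent to [F].  The two corresponding parts of the link are hemispheres glued
    along the unit sphere of the tangent space of [F], which consists of the unit
    vectors having coordinates in both [S1] and [S2]; distances are
    truncated at [pi]. *)
Definition link_dist S1 x1 w1 S2 x2 w2 : \bar R :=
  Order.min (pi : R)%:E (ereal_inf [set a | exists e1 e2,
    [/\ dchart S1 e1 = dchart S2 e2, gnorm S1 x1 e1 = 1 &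
     a = (acos (bilin (gram S1 x1) w1 e1) + acos (bilin (gram S2 x2) w2 e2))%:E]]).

(** A maximal geodesic of the interior of a top simplex, on a time interval from
    [seg_start] to [seg_end]. *)
Record segment := Segment {
  seg_simplex : {fset V} ;
  seg_start : R ;
  seg_end : \bar R ;
  seg_coord : R -> 'rV[R]_n }.

Implicit Types a b : segment.

Definition seg_dom a : set R := [set t | seg_start a <= t /\ (t%:E <= seg_end a)%E].

Definition seg_point a (t : R) : K := theta (chart (seg_simplex a) (seg_coord a t)).

Definition is_segment a : Prop :=
  [/\ top_simplex n (seg_simplex a),
      ((seg_start a)%:E < seg_end a)%E,
      {within seg_dom a, continuous (seg_coord a)} /\
        (forall t, seg_dom a t -> std_simplex (seg_coord a t)),
      forall t, seg_start a < t -> (t%:E < seg_end a)%E ->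
        geodesic_at (seg_simplex a) (seg_coord a) t &
      forall e, seg_end a = e%:E -> ~ std_open_simplex (seg_coord a e)].

Definition initial_segment p S v a : Prop :=
  [/\ is_segment a, seg_simplex a = S, seg_start a = 0, seg_point a 0 = p
    & velocity_right (seg_coord a) 0 v].

Definition adjacent F S : {fset {fset V}} :=
  fset_set [set S' | [/\ top_simplex n S', (F `<=` S')%fset & S' <> S]].

(** [b] continues [a] across an interior point of an [(n-1)]-simplex, the next top
    simplex being selected among the [m] other adjacent ones by a number [u] which
    is uniform in [[0, 1]]: it is the one of rank [floor (m u)]. *)
Definition continues (u : R) a b : Prop :=
  let S1 := seg_simplex a in let S2 := seg_simplex b in
  let s := seg_start b in
  let x1 := seg_coord a s in let x2 := seg_coord b s in
  [/\ is_segment b, seg_end a = s%:E, chart S1 x1 = chart S2 x2,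
   exists F, [/\ #|` F|%fset = n, open_simplex F (chart S1 x1),
     S2 \in adjacent F S1 &
     index S2 (enum_fset (adjacent F S1)) = Num.truncn (u * #|` adjacent F S1|%fset%:R)] &
   exists v1 v2, [/\ velocity_left (seg_coord a) s v1,
     velocity_right (seg_coord b) s v2,
     gnorm S1 x1 v1 = gnorm S2 x2 v2 &
     link_dist S1 x1 (unit_dir S1 x1 (- v1)) S2 x2 (unit_dir S2 x2 v2) = (pi : R)%:E]].

(** [Y] is the trajectory of the generalized geodesic flow from [p] with initial
    velocity [v] in [S], the [k]-th crossing being directed by [u k].  It is
    followed as long as it can be continued, and sent to the added point [None] of
    the compactification after its lifetime. *)
Definition gen_geodesic p S v (u : nat -> R) (Y : R -> opc) : Prop :=
  exists q : nat -> option segment,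
  [/\ if q 0 is Some a then initial_segment p S v a
      else ~ exists a, initial_segment p S v a,
      forall k, match q k, q k.+1 with
        | Some a, Some b => continues (u k) a b
        | Some a, None => ~ exists b, continues (u k) a b
        | None, next => next = None
        end,
      forall k a t, q k = Some a -> seg_dom a t -> Y t = Some (seg_point a t) &
      forall t, 0 <= t -> (forall k a, q k = Some a -> ~ seg_dom a t) -> Y t = None].

End Flow.

Section Walk.
Variables (R : realType) (K : riem_polyhedron R).
Local Notation V := (vertex K).
Local Notation n := (dim K).
Local Notation opc := (one_point_compactification K).

(** [C(R^+, K)], with values in the compactification; a path is extended to negative
    times by its initial value.  Its topology is that of uniform convergence on
    compact sets. *)
Definition paths : set {compact-open, R -> opc} :=
  [set w | continuous (w : R -> opc) /\ forall t : R, t <= 0 -> w t = w 0].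

Section Data.
Variables (Om : Type) (Z : nat -> Om -> {fset V} * 'rV[R]_n).
Variables (T : nat -> Om -> R) (U : nat -> nat -> Om -> R).
Variable leg : nat -> Om -> R -> opc.

Definition direction_event (i : nat) : set (set Om) :=
  [set E | exists S A, borel A /\ E = [set w | (Z i w).1 = S /\ A (Z i w).2]].

Definition past_event (i : nat) : set (set Om) :=
  [set E | exists2 j, (j < i)%N & direction_event j E \/
     (exists2 A, measurable A & E = T j @^-1` A) \/
     (exists k, exists2 A, measurable A & E = U j k @^-1` A)].

(** [walk_time i] is [tau_i] and [walk_position p i] the position at that time. *)
Definition walk_time (i : nat) (w : Om) : R := \sum_(j < i) T j w.

Definition walk_position (p : K) (i : nat) (w : Om) : opc :=
  if i is j.+1 then leg j w (T j w) else Some p.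

End Data.

(** [Y] is (a version of) [Y^eta] started at [p], on the probability space
    [(Om, P)].  The increments [T i] are exponential with parameter [2 / n]: a jump
    of duration [T] and speed [eta] in a uniform direction of [R^n] has covariance
    [eta^2 E[T^2] / n] times the identity and lasts [eta^2 E[T]] on average after
    the change of time, so that the limit is generated by [Delta / 2] iff
    [E[T^2] = n E[T]].  *)
Definition is_walk (eta : R) (p : K) d (Om : measurableType d)
    (P : probability Om R) (Y : R -> Om -> opc) : Prop :=
  exists (Z : nat -> Om -> {fset V} * 'rV[R]_n) (T : nat -> Om -> R)
         (U : nat -> nat -> Om -> R) (leg : nat -> Om -> R -> opc),
  let past i := <<s past_event Z T U i >> in
  let past_and_direction i := <<s past_event Z T U i `|` direction_event Z i >> in
  let pos := walk_position T leg p in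
  let tau := walk_time T in
  [/\ forall i E, past_event Z T U i E -> measurable E,
      forall i (A : set opc), open A -> past i (pos i @^-1` A),
      forall i H S A, past i H -> borel A ->
        P (H `&` [set w | pos i w <> None /\ (Z i w).1 = S /\ A (Z i w).2])
        = (\int[P]_(w in H) (link_law (pos i w) S A)%:E)%E,
      forall i H A (m : nat) (D : nat -> set R), past_and_direction i H ->
        measurable A -> (forall k, measurable (D k)) ->
        P (H `&` T i @^-1` A `&` \bigcap_(k in `I_m) (U i k @^-1` D k))
        = (P H * exponential_prob (2 / n%:R) A *
            \prod_(k < m) uniform_prob (@ltr01 R) (D k))%E &
   [/\ {ae P, forall w, forall i, if pos i w is Some x
          then gen_geodesic x (Z i w).1 (eta *: (Z i w).2) (U i ^~ w) (leg i w)
          else leg i w = (fun=> None)},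
      {ae P, forall w, forall i t, 0 <= t ->
        tau i w <= t / eta ^+ 2 <= tau i.+1 w ->
        Y t w = leg i w (t / eta ^+ 2 - tau i w)},
      {ae P, forall w, paths (Y ^~ w)} &
      forall t (A : set opc), open A -> measurable (Y t @^-1` A)]].

Section Process.
Variables (d : measure_display) (Om : measurableType d).
Variables (P : K -> probability Om R) (B : R -> Om -> opc).

Definition extend0 (f : K -> R) (q : opc) : R := if q is Some p then f p else 0.

Definition bounded_borel (f : K -> R) : Prop :=
  borel_fun f /\ exists M : R, forall p, `|f p| <= M.

Definition semigroup (t : R) (f : K -> R) (p : K) : R :=
  fine ('E_(P p)[fun w => extend0 f (B t w)])%E.

Definition is_markov : Prop :=
  (forall t (A : set opc), 0 <= t -> borel A ->
     borel_fun (fun p => fine (P p (B t @^-1` A)))) /\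
  (forall p f s t H, bounded_borel f -> 0 <= s -> 0 <= t ->
     <<s [set E | exists r, exists2 A : set opc, 0 <= r <= s /\ open A
                                         & E = B r @^-1` A] >> H ->
     (\int[P p]_(w in H) (extend0 f (B (s + t) w))%:E =
      \int[P p]_(w in H) (extend0 (semigroup t f) (B s w))%:E)%E).

(** The law of [B] under [P p] is the limit of the laws of the walks [Y^eta] started
    at [p], along some sequence of parameters [eta] converging to [0]. *)
Definition is_wiener (p : K) : Prop :=
  exists eta : nat -> R, [/\ forall k, 0 < eta k <= 1, eta k @[k --> \oo] --> 0 &
  exists (dW : nat -> measure_display) (OW : forall k, measurableType (dW k))
    (PW : forall k, probability (OW k) R) (Y : forall k, R -> OW k -> opc),
  (forall k, is_walk (eta k) p (PW k) (Y k)) /\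
  forall F : {compact-open, R -> opc} -> R,
    {within paths, continuous F} ->
    (exists M : R, forall w, paths w -> `|F w| <= M) ->
    'E_(PW k)[fun w => F (Y k ^~ w)]%E @[k --> \oo] --> 'E_(P p)[fun w => F (B ^~ w)]%E].

Record brownian_motion : Prop := {
  brownian_measurable : forall t (A : set opc), open A -> measurable (B t @^-1` A) ;
  brownian_start : forall p, P p [set w | B 0 w = Some p] = 1%E ;
  brownian_continuous : forall w, paths (B ^~ w) ;
  brownian_wiener : forall p, is_wiener p ;
  brownian_markov : is_markov }.

Definition generator_limit (f g : K -> R) : Prop :=
  {uniform, (fun t : R => fun p : K => (semigroup t f p - f p) / t) @ 0^'+ --> g}.

Definition generator_domain : set (K -> R) :=
  [set f | bounded_borel f /\ exists g, generator_limit f g].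

End Process.

Definition sup_norm (f : K -> R) : R := sup [set `|f p| | p in [set: K]].

(** The supremum norm is not complete on the domain of an unbounded generator; the
    Banach norm of the domain is the graph norm. *)
Definition graph_norm (L : (K -> R) -> K -> R) (f : K -> R) : R :=
  sup_norm f + sup_norm (L f).

End Walk.

(* Main.v *)
Require Import Defs.
From HB Require Import structures.
From mathcomp Require Import all_boot all_order all_algebra finmap.
From mathcomp Require Import all_classical all_reals all_analysis.
From mathcomp Require Import measurable_realfun ring.

Set Implicit Arguments.
Unset Strict Implicit.
Unset Printing Implicit Defensive.

Import Order.TTheory GRing.Theory Num.Theory.
Import numFieldNormedType.Exports.

Local Open Scope classical_set_scope.
Local Open Scope ring_scope.

(** Bounded Borel functions form a Banach space on which the transition operators
    [T t] are linear contractions with [T (s + t) = T s (T t)].  The limit in the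
    generator is unique and inherits linearity and Borel measurability.  Summing
    [T (k s) (T s h - h)] over [k < t / s] and letting [s] tend to [0] yields
    [|T t h - h| <= t |L h|] without integrating in time; hence the difference
    quotients of a graph-Cauchy sequence converge uniformly in [t], and [L] is
    closed. *)

(** * Preimages of Borel sets *)

(** The sets with Borel preimage form a sigma-algebra, so it suffices to test generators. *)
Lemma borel_preimage_gen (T : topologicalType) (U : Type) (f : T -> U)
    (G : set (set U)) (A : set U) :
  (forall X, G X -> borel (f @^-1` X)) -> <<s G >> A -> borel (f @^-1` A).
Proof.
move=> bG sA; apply: (sA [set A | borel (f @^-1` A)]); split=> //; split=> /=.
- by rewrite preimage_set0; exact: sigma_algebra0.
- by move=> X bX; rewrite setTD preimage_setC -setTD; exact: sigma_algebraCD.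
- by move=> X bX; rewrite preimage_bigcup; exact: sigma_algebra_bigcup.
Qed.

Lemma borel_preimage (R : realType) (T : topologicalType) (f : T -> R) (A : set R) :
  borel_fun f -> measurable A -> borel (f @^-1` A).
Proof.
move=> bf mA.
have {}mA : <<s RGenOpens.G (R:=R) >> A.
  by rewrite -[<<s _ >>]RGenOpens.measurableE.
apply: borel_preimage_gen mA => _ [x [y ->]].
by apply: bf; exact: interval_open.
Qed.

Lemma borel_continuous (T U : topologicalType) (f : T -> U) (A : set U) :
  continuous f -> borel A -> borel (f @^-1` A).
Proof.
move=> /continuousP cf; apply: borel_preimage_gen => X oX.
by apply: sub_sigma_algebra; exact: cf.
Qed.

(** * Borel functions extended by zero to the one-point compactification *)

Section OnePoint.
Variables (R : realType) (K : riem_polyhedron R).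
Local Notation opc := (one_point_compactification K).
Local Notation opcB := (g_sigma_algebraType [set A : set opc | open A]).

(** The embedding of [K] is open and injective. Its image is not the whole compactification, so
    complements are taken relative to that image, itself open. *)
Lemma borel_some (A : set K) : borel A -> borel (Some @` A : set opc).
Proof.
have oS : open (Some @` [set: K] : set opc).
  by apply: one_point_compactification_open_some; exact: openT.
move=> bA; apply: (bA [set A | borel (Some @` A : set opc)]); split; last first.
  move=> X oX; apply: sub_sigma_algebra.
  exact: one_point_compactification_open_some.
split=> /=.
- by rewrite image_set0; exact: sigma_algebra0.
- move=> X bX.
  have -> : Some @` (setT `\` X) = (Some @` setT : set opc) `\` Some @` X.
    apply/seteqP; split=> [_ [x [_ nX] <-]|_ [[x _ <-] nX]].
      by split; [exists x|case=> y + [yx]; rewrite yx].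
    by exists x => //; split => // Xx; apply: nX; exists x.
  apply: (@measurableD _ opcB _ _ _ bX).
  exact: sub_sigma_algebra.
- move=> F bF; rewrite image_bigcup; exact: sigma_algebra_bigcup.
Qed.

(** Transfers the calculus of measurable functions to [borel_fun]. Forwards, a preimage under the
    extension is the image of one under [f], with the Borel set [[set None]] added when [A] contains
    0. Backwards, [f] is the extension composed with the continuous embedding. *)
Lemma extend0_measurable (f : K -> R) :
  borel_fun f <-> measurable_fun [set: opcB] (extend0 f : opcB -> R).
Proof.
split=> [bf _ A mA|mf A oA].
- rewrite setTI.
  have mS : @measurable _ opcB (Some @` (f @^-1` A)).
    by apply: borel_some; exact: borel_preimage.
  have mN : @measurable _ opcB [set None].
    have -> : [set None] = ~` (Some @` [set: K]) :> set opc.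
      apply/seteqP; split=> [_ -> [x]//|[x|]//= nx].
      by exfalso; apply: nx; exists x.
    apply: measurableC; apply: sub_sigma_algebra.
    by apply: one_point_compactification_open_some; exact: openT.
  have [A0|A0] := pselect (A 0).
  + have -> : (extend0 f : opcB -> R) @^-1` A = Some @` (f @^-1` A) `|` [set None].
      apply/seteqP; split=> [[x|] //=|_ [[x ? <-]|->]//].
        by left; exists x.
      by right.
    exact: measurableU.
  + have -> : (extend0 f : opcB -> R) @^-1` A = Some @` (f @^-1` A).
      apply/seteqP; split=> [[x|] //=|_ [x ? <-]//].
      by exists x.
    by [].
- have -> : f = (extend0 f : opcB -> R) \o (Some : K -> opc) by [].
  rewrite comp_preimage; apply: borel_continuous.
    exact: one_point_compactification_some_continuous.
  have := mf measurableT A (open_measurable oA); rewrite setTI; exact.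
Qed.

Lemma borel_lin (a : R) (f h : K -> R) :
  borel_fun f -> borel_fun h -> borel_fun (fun p => a * f p + h p).
Proof.
move=> /extend0_measurable mf /extend0_measurable mh.
apply/extend0_measurable.
have -> : extend0 (fun p => a * f p + h p) =
    (fun q : opcB => a * extend0 f q + extend0 h q).
  by apply/funext => -[p|] //=; rewrite mulr0 addr0.
by apply: measurable_funD => //; apply: measurable_funM.
Qed.

Lemma borel_cvg (u : nat -> K -> R) (f : K -> R) :
  (forall k, borel_fun (u k)) -> (forall p, u ^~ p @ \oo --> f p) -> borel_fun f.
Proof.
move=> mu cu; apply/extend0_measurable.
apply: (@measurable_fun_cvg _ _ _ _ (fun k => extend0 (u k) : opcB -> R)).
  by move=> k; exact/extend0_measurable.
by move=> [p|] _ //=; exact: cvg_cst.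
Qed.

End OnePoint.

(** * Bounded Borel functions and the supremum norm *)

Section BoundedBorel.
Variables (R : realType) (K : riem_polyhedron R).
Implicit Types f h : K -> R.

Lemma bounded_borel_lin (a : R) f h : bounded_borel f -> bounded_borel h ->
  bounded_borel (fun p => a * f p + h p).
Proof.
move=> [bf [M fM]] [bh [N hN]]; split; first exact: borel_lin.
exists (`|a| * M + N) => p; rewrite (le_trans (ler_normD _ _))// lerD// normrM.
exact: ler_wpM2l.
Qed.

Lemma bounded_borel_cst (c : R) : bounded_borel (fun _ : K => c).
Proof.
split; last by exists `|c|.
move=> A _; rewrite [_ @^-1` A](preimage_cst c A); case: ifP => _.
  rewrite -setC0 -setTD; apply: sigma_algebraCD; exact: sigma_algebra0.
exact: sigma_algebra0.
Qed.

Lemma bounded_borelB f h : bounded_borel f -> bounded_borel h ->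
  bounded_borel (fun p => f p - h p).
Proof.
move=> bf bh; rewrite (_ : (fun p => _) = (fun p => -1 * h p + f p)).
  exact: bounded_borel_lin.
by apply/funext => p; rewrite mulN1r addrC.
Qed.

Lemma bounded_borel_uniform (u : nat -> K -> R) f :
  (forall k, bounded_borel (u k)) ->
  (forall e, 0 < e -> exists N, forall k p, (N <= k)%N -> `|u k p - f p| <= e) ->
  bounded_borel f.
Proof.
move=> bu uf; split.
  apply: (borel_cvg (fun k => (bu k).1)) => p; apply/cvgrPdist_le => e /uf[N NP].
  by exists N => // k /= Nk; rewrite distrC NP.
(* One term within distance 1 of [f] already bounds it. *)
have [N /(_ N _ (leqnn N)) NP] := uf 1 ltr01.
have [M uM] := (bu N).2.
exists (M + 1) => p; have -> : f p = u N p - (u N p - f p) by rewrite subKr.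
by rewrite (le_trans (ler_normB _ _))// lerD.
Qed.

(** Pointwise limits exist by completeness of [R]; letting [m] tend to infinity in the Cauchy bound
    makes the convergence uniform. *)
Lemma uniform_cauchy (u : nat -> K -> R) :
  (forall e, 0 < e -> exists N, forall k m p, (N <= k)%N -> (N <= m)%N ->
     `|u k p - u m p| <= e) ->
  exists f, forall e, 0 < e ->
    exists N, forall k p, (N <= k)%N -> `|u k p - f p| <= e.
Proof.
move=> cu.
have cvgu p : cvgn (u ^~ p).
  apply/cauchy_cvgP/cauchy_exP => e e0.
  have [N NP] := cu (e / 2) (divr_gt0 e0 (ltr0n _ 2)).
  exists (u N p); exists N => // k /= Nk; rewrite /ball/=.
  by rewrite (le_lt_trans (NP _ _ _ _ _))// ltr_pdivrMr// ltr_pMr// ltr1n.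
exists (fun p => limn (u ^~ p)) => e /cu[N NP]; exists N => k p Nk.
have cv : `|u k p - u m p| @[m --> \oo] --> `|u k p - limn (u ^~ p)|.
  by apply: cvg_norm; apply: cvgB; [exact: cvg_cst|exact: cvgu].
rewrite -(cvg_lim _ cv)//; apply: limr_le; first by apply/cvg_ex; eexists; exact: cv.
by exists N => // m /= Nm; exact: NP.
Qed.

Lemma sup_norm_ge f p : bounded_borel f -> `|f p| <= sup_norm f.
Proof.
move=> [_ [M fM]]; apply: ub_le_sup; last by exists p.
by exists M => _ [q _ <-].
Qed.

(** The sign of [e] covers an empty [K], where the supremum takes its default value 0. *)
Lemma sup_norm_le f e : 0 <= e -> (forall p, `|f p| <= e) -> sup_norm f <= e.
Proof.
move=> e0 fe; have [[p _]|K0] := pselect (exists p : K, True).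
  by apply: ge_sup; [exists `|f p|, p|move=> _ [q _ <-]].
rewrite /sup_norm (_ : [set _ | _ in _] = set0) ?sup0//.
by apply/seteqP; split=> // x [p _ _]; exfalso; apply: K0; exists p.
Qed.

Lemma sup_norm_ge0 f : bounded_borel f -> 0 <= sup_norm f.
Proof.
move=> bf; have [[p _]|K0] := pselect (exists p : K, True).
  exact: le_trans (sup_norm_ge p bf).
rewrite /sup_norm (_ : [set _ | _ in _] = set0) ?sup0//.
by apply/seteqP; split=> // x [p _ _]; exfalso; apply: K0; exists p.
Qed.

End BoundedBorel.

(** * The transition semigroup on bounded Borel functions *)

Section Semigroup.
Variables (R : realType) (K : riem_polyhedron R).
Variables (d : measure_display) (Om : measurableType d).
Variables (P : K -> probability Om R) (B : R -> Om -> one_point_compactification K).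
Local Notation opc := (one_point_compactification K).
Local Notation opcB := (g_sigma_algebraType [set A : set opc | open A]).
Hypothesis mB : forall t (A : set opc), open A -> measurable (B t @^-1` A).
Hypothesis markovB : is_markov P B.
Implicit Types f h : K -> R.
Local Notation T := (semigroup P B).

Let measurable_B t : measurable_fun setT (B t : Om -> opcB).
Proof.
apply: (@measurability _ _ _ opcB _ _ [set A : set opc | open A]) => // _ [A oA <-].
by rewrite setTI; exact: mB.
Qed.

Let measurable_fB f t : borel_fun f ->
  measurable_fun setT (fun w => extend0 f (B t w)).
Proof.
move=> /extend0_measurable mf.
exact: (measurableT_comp mf (measurable_B t)).
Qed.

Let extend0_le f M q : (forall p, `|f p| <= M) -> 0 <= M -> `|extend0 f q| <= M.
Proof. by case: q => [p|] //= _; rewrite normr0. Qed.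

Let integrable_cst c p : (P p).-integrable setT (EFin \o (fun _ : Om => c)).
Proof.
apply: measurable_bounded_integrable => //; last exact: bounded_cst.
by rewrite (le_lt_trans (probability_le1 _ _))// ltry.
Qed.

Let integrable_fB f t p : bounded_borel f ->
  (P p).-integrable setT (EFin \o (fun w => extend0 f (B t w))).
Proof.
move=> [bf [M fM]]; apply: measurable_bounded_integrable => //.
- by rewrite (le_lt_trans (probability_le1 _ _))// ltry.
- exact: measurable_fB.
- have M0 : 0 <= M := le_trans (normr_ge0 _) (fM p).
  exists M; split; first exact: num_real.
  move=> x Mx w _ /=.
  by rewrite (le_trans (extend0_le _ fM _))// ltW.
Qed.

Lemma semigroupE t f p : T t f p = (\int[P p]_w extend0 f (B t w))%R.
Proof. by rewrite /semigroup unlock. Qed.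

Lemma semigroup_lin (a : R) f h t p : bounded_borel f -> bounded_borel h ->
  T t (fun p => a * f p + h p) p = a * T t f p + T t h p.
Proof.
move=> bf bh; rewrite !semigroupE -RintegralZl//; last exact: integrable_fB.
rewrite -RintegralD//; last 2 first.
- by have := integrableZl measurableT a (integrable_fB t p bf).
- exact: integrable_fB.
by apply: eq_Rintegral => w _; case: (B t w) => //=; rewrite mulr0 addr0.
Qed.

Lemma semigroupB f h t p : bounded_borel f -> bounded_borel h ->
  T t (fun p => f p - h p) p = T t f p - T t h p.
Proof.
move=> bf bh; rewrite (_ : (fun p => _) = (fun p => -1 * h p + f p)).
  by rewrite semigroup_lin// mulN1r addrC.
by apply/funext => q; rewrite mulN1r addrC.
Qed.

(** [P p] has total mass one, and the value 0 at the added point respects the bound because [M] is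
    nonnegative. *)
Lemma semigroup_contraction f (M : R) t p : bounded_borel f ->
  (forall p, `|f p| <= M) -> `|T t f p| <= M.
Proof.
move=> bf fM; have M0 : 0 <= M := le_trans (normr_ge0 _) (fM p).
rewrite semigroupE (le_trans (le_normr_Rintegral _ _))//; first exact: integrable_fB.
have -> : M = (\int[P p]_(w in setT) M)%R.
  by rewrite Rintegral_cst// [X in fine X](probability_setT (P p)) mulr1.
apply: le_Rintegral => //.
- exact: integrable_norm (integrable_fB t p bf).
- exact: integrable_cst.
- by move=> w _; exact: extend0_le.
Qed.

(** This is the Markov property at time [s], taken on the sure event. *)
Lemma semigroupD f s t p : bounded_borel f -> 0 <= s -> 0 <= t ->
  T (s + t) f p = T s (T t f) p.
Proof.
move=> bf s0 t0; rewrite !semigroupE /Rintegral; congr fine.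
apply: (markovB.2 p f s t setT bf s0 t0).
exact: (@measurableT _ (g_sigma_algebraType _)).
Qed.

(** The Markov property gives Borel dependence on [p] for probabilities of events. Integration
    against the resulting kernel carries it over to expectations. *)
Lemma semigroup_bounded_borel f t : 0 <= t -> bounded_borel f ->
  bounded_borel (T t f).
Proof.
move=> t0 bf; have [_ [M fM]] := bf; split; last first.
  by exists M => p; exact: semigroup_contraction.
(* A shift by [|M|] makes the integrand nonnegative, as integration against a kernel requires; it is
   subtracted again below. *)
pose k (q : opcB) := (extend0 f q + `|M|)%:E.
have k0 q : (0 <= k q)%E.
  rewrite lee_fin -lerBlDr sub0r; case: q => [p|] /=; last by rewrite oppr_le0.
  by have := fM p; rewrite ler_norml => /andP[+ _]; apply: le_trans;
    rewrite lerN2 ler_norm.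
have mk : measurable_fun setT k.
  apply/measurable_EFinP; apply: measurable_funD => //.
  by apply/extend0_measurable; exact: bf.1.
(* The kernel sends [p] to the law of [B t] under [P p], and the added point to the zero measure.
   The measurability of [B t] remains an argument of [l_]. *)
pose l_ (q : opcB) : {measure set opcB -> \bar R} :=
  if q is Some p then pushforward (P p) (B t : Om -> opcB) else mzero.
pose l := l_ (measurable_B t).
have ml U : measurable U -> measurable_fun [set: opcB] (l ^~ U).
  move=> mU; rewrite (_ : l ^~ U = EFin \o
      (extend0 (fun p => fine (P p (B t @^-1` U))) : opcB -> R)).
    by apply/measurable_EFinP/extend0_measurable; exact: markovB.1.
  by apply/funext => -[p|] //=; rewrite fineK ?fin_num_measure// -[X in measurable X]setTI;
    exact: measurable_B.
apply/extend0_measurable.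
rewrite (_ : extend0 _ = (fun q : opcB => fine (\int[l q]_y k y)%E -
    (extend0 (fun=> `|M|) : opcB -> R) q)).
  apply: measurable_funB.
    by apply: measurableT_comp => //; exact: measurable_fun_integral_kernel.
  by apply/extend0_measurable; exact: (bounded_borel_cst K _).1.
apply/funext => -[p|] /=; last by rewrite integral_measure_zero subr0.
rewrite semigroupE ge0_integral_pushforward//.
rewrite preimage_setT.
have -> : fine (\int[P p]_w (k \o B t) w)%E =
   (\int[P p]_w (extend0 f (B t w) + `|M|))%R by [].
rewrite RintegralD//; last 2 first.
- exact: integrable_fB.
- exact: integrable_cst.
by rewrite Rintegral_cst// [X in fine X](probability_setT (P p)) mulr1 addrK.
Qed.

End Semigroup.

(** * Limits of difference quotients and closedness of the generator *)

Section Generator.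
Variables (R : realType) (K : riem_polyhedron R).
Variables (d : measure_display) (Om : measurableType d).
Variables (P : K -> probability Om R) (B : R -> Om -> one_point_compactification K).
Local Notation opc := (one_point_compactification K).
Hypothesis mB : forall t (A : set opc), open A -> measurable (B t @^-1` A).
Hypothesis markovB : is_markov P B.
Implicit Types f g h : K -> R.
Local Notation T := (semigroup P B).

Lemma generator_limitP f g : generator_limit P B f g <->
  forall e, 0 < e -> exists2 r, 0 < r &
    forall t p, 0 < t < r -> `|(T t f p - f p) / t - g p| <= e.
Proof.
split=> [lim_fg e e0|lim_fg].
  have : nbhs (g : {uniform K -> R}) [set h | forall p, `|h p - g p| <= e].
    apply/uniform_nbhs; exists [set xy : R * R | `|xy.1 - xy.2| < e]; split.
      by rewrite -entourage_ballE; exists e.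
    by move=> h /= hg p; rewrite distrC ltW// hg.
  move=> /lim_fg[r /= r0 rP]; exists r => // t p /andP[t0 tr].
  by apply: rP => //=; rewrite sub0r normrN gtr0_norm.
move=> A /uniform_nbhs[E [+ EA]].
rewrite -entourage_ballE => -[e /= e0 eE].
have [r r0 rP] := lim_fg (e / 2) (divr_gt0 e0 (ltr0n _ 2)).
exists r => //= t /=; rewrite sub0r normrN => tr t0; apply: EA => p _.
apply: eE => /=; rewrite /ball/= distrC (le_lt_trans (rP _ _ _))//.
  by rewrite t0 (le_lt_trans (ler_norm _)).
by rewrite ltr_pdivrMr// ltr_pMr// ltr1n.
Qed.

Lemma generator_limit_unique f g h :
  generator_limit P B f g -> generator_limit P B f h -> g = h.
Proof.
move=> /generator_limitP fg /generator_limitP fh; apply/funext => p.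
apply/eqP; rewrite -subr_eq0 -normr_le0; apply/ler_addgt0Pr => e e0.
have e20 : 0 < e / 2 by rewrite divr_gt0.
have [r r0 rP] := fg _ e20; have [s s0 sP] := fh _ e20.
pose t := Num.min r s / 2.
have m0 : 0 < Num.min r s by rewrite lt_min r0.
have t0 : 0 < t by rewrite divr_gt0.
have tm : t < Num.min r s by rewrite ltr_pdivrMr// ltr_pMr// ltr1n.
move: tm; rewrite lt_min => /andP[tr ts].
have -> : g p - h p = ((T t f p - f p) / t - h p) - ((T t f p - f p) / t - g p) by ring.
rewrite add0r (splitr e) (le_trans (ler_normB _ _))// lerD//.
  by apply: sP; rewrite t0.
by apply: rP; rewrite t0.
Qed.

Lemma generator_limit_cst0 : generator_limit P B (fun=> 0) (fun=> 0).
Proof.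
apply/generator_limitP => e e0; exists 1 => // t p _.
have : `|T t (fun=> 0) p| <= 0.
  apply: semigroup_contraction => //; first exact: bounded_borel_cst.
  by move=> q; rewrite normr0.
rewrite normr_le0 => /eqP ->.
by rewrite !subr0 mul0r normr0 ltW.
Qed.

Lemma generator_limit_lin a f g h i :
  bounded_borel f -> bounded_borel h ->
  generator_limit P B f g -> generator_limit P B h i ->
  generator_limit P B (fun p => a * f p + h p) (fun p => a * g p + i p).
Proof.
move=> bf bh /generator_limitP fg /generator_limitP hi.
apply/generator_limitP => e e0.
have e20 : 0 < e / 2 by rewrite divr_gt0.
(* Dividing by [|a| + 1] rather than [|a|] allows [a = 0]. *)
have a0 : 0 < `|a| + 1 by rewrite ltr_wpDl.
have [r r0 rP] := fg _ (divr_gt0 e20 a0); have [s s0 sP] := hi _ e20.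
exists (Num.min r s); first by rewrite lt_min r0.
move=> t p; rewrite lt_min => /and3P[t0 tr ts].
rewrite semigroup_lin//.
have -> : (a * T t f p + T t h p - (a * f p + h p)) / t - (a * g p + i p) =
    a * ((T t f p - f p) / t - g p) + ((T t h p - h p) / t - i p) by ring.
rewrite (splitr e) (le_trans (ler_normD _ _))// lerD//; last by apply: sP; rewrite t0.
rewrite normrM (@le_trans _ _ (`|a| * (e / 2 / (`|a| + 1))))//.
  by rewrite ler_wpM2l// rP// t0.
by rewrite mulrCA ler_piMr ?(ltW e20)// ler_pdivrMr// mul1r lerDl.
Qed.

Lemma generator_limitB f g h i :
  bounded_borel f -> bounded_borel h ->
  generator_limit P B f g -> generator_limit P B h i ->
  generator_limit P B (fun p => f p - h p) (fun p => g p - i p).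
Proof.
move=> bf bh fg hi.
have BE (f1 f2 : K -> R) : (fun p => f1 p - f2 p) = (fun p => -1 * f2 p + f1 p).
  by apply/funext => p; rewrite mulN1r addrC.
by rewrite !BE; exact: generator_limit_lin.
Qed.

(** The difference quotients at the times [1 / (k + 1)] are bounded Borel and converge uniformly to
    [g]. *)
Lemma generator_limit_bounded_borel f g : bounded_borel f ->
  generator_limit P B f g -> bounded_borel g.
Proof.
move=> bf /generator_limitP fg.
apply: (@bounded_borel_uniform _ _
  (fun k p => k.+1%:R * (T k.+1%:R^-1 f p - f p) + 0)).
  move=> k; apply: bounded_borel_lin; last exact: bounded_borel_cst.
  apply: bounded_borelB => //; exact: semigroup_bounded_borel.
move=> e /fg[r r0 rP]; exists (Num.truncn r^-1) => k p kN.
rewrite addr0 mulrC -[X in _ * X]invrK; apply: rP.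
rewrite invr_gt0 ltr0n/= invf_plt ?posrE//.
by rewrite (lt_le_trans (truncnS_gt _))// ler_nat ltnS.
Qed.

(** A mean value inequality: over a short time [s] the increment is at most about [s * c], and
    contractivity lets the bounds of successive steps add up. *)
Lemma semigroup_increment_le h g c t p : bounded_borel h ->
  generator_limit P B h g -> (forall q, `|g q| <= c) -> 0 < t ->
  `|T t h p - h p| <= t * c.
Proof.
move=> bh /generator_limitP hg gc t0; apply/ler_addgt0Pr => e e0.
have [r r0 rP] := hg _ (divr_gt0 e0 t0).
(* With [N + 1 > t / r] equal steps, each is shorter than [r]. The error [e / t] in the quotient
   then sums to [e] over total time [t]. *)
pose N := Num.truncn (t / r); pose s := t / N.+1%:R.
have s0 : 0 < s by rewrite divr_gt0.
have sr : s < r.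
  by rewrite ltr_pdivrMr// mulrC -ltr_pdivrMr//; exact: truncnS_gt.
have step q : `|T s h q - h q| <= s * (c + e / t).
  have -> : T s h q - h q = s * ((T s h q - h q) / s - g q + g q).
    by rewrite subrK mulrC divfK// gt_eqF.
  rewrite normrM gtr0_norm// ler_pM2l// addrC (le_trans (ler_normD _ _))//.
  by rewrite lerD// rP// s0.
have steps n q : `|T (n.+1%:R * s) h q - h q| <= n.+1%:R * (s * (c + e / t)).
  elim: n q => [|n IHn] q; first by rewrite !mul1r.
  have -> : n.+2%:R * s = s + n.+1%:R * s by rewrite -[n.+2]add1n natrD mulrDl mul1r.
  rewrite -[n.+2]addn1 natrD [leRHS]mulrDl mul1r.
  have ns0 : 0 <= n.+1%:R * s by rewrite mulr_ge0// ltW.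
  have bn := semigroup_bounded_borel mB markovB ns0 bh.
  rewrite (semigroupD markovB _ bh (ltW s0) ns0).
  (* Telescoping: contractivity bounds the first term by the induction hypothesis, and [step] bounds
     the second. *)
  have -> : T s (T (n.+1%:R * s) h) q - h q =
      T s (fun q => T (n.+1%:R * s) h q - h q) q + (T s h q - h q).
    by rewrite semigroupB// addrA subrK.
  rewrite (le_trans (ler_normD _ _))// lerD//.
  by apply: semigroup_contraction => //; exact: bounded_borelB.
have Ns : N.+1%:R * s = t by rewrite mulrC divfK.
have := steps N p; rewrite [leRHS]mulrA Ns.
by rewrite mulrDr [t * (e / t)]mulrC divfK// gt_eqF.
Qed.

(** An interchange of limits: the increment bound, applied to [u m - u N], carries a factor [t] that
    cancels the division by [t], so one index [N] serves all small times. *)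
Lemma generator_closed (u v : nat -> K -> R) f g :
  (forall k, bounded_borel (u k)) -> bounded_borel f ->
  (forall k, generator_limit P B (u k) (v k)) ->
  (forall e, 0 < e -> exists N, forall k p, (N <= k)%N -> `|u k p - f p| <= e) ->
  (forall e, 0 < e -> exists N, forall k p, (N <= k)%N -> `|v k p - g p| <= e) ->
  generator_limit P B f g.
Proof.
move=> bu bf lim_uv uf vg; apply/generator_limitP => e e0.
have e40 : 0 < e / 4 by rewrite divr_gt0.
have [N vN] := vg _ e40.
have /generator_limitP/(_ _ e40)[r r0 rP] := lim_uv N.
exists r => // t p tr; have t0 : 0 < t by case/andP: tr.
suff Tfu : `|(T t f p - f p) - (T t (u N) p - u N p)| <= t * (e / 4 + e / 4).
  have -> : (T t f p - f p) / t - g p =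
    ((T t f p - f p) - (T t (u N) p - u N p)) / t +
    ((T t (u N) p - u N p) / t - v N p) + (v N p - g p) by ring.
  have -> : e = (e / 4 + e / 4) + e / 4 + e / 4 by field.
  rewrite (le_trans (ler_normD _ _))// lerD ?vN// (le_trans (ler_normD _ _))//.
  rewrite lerD ?rP// normrM [X in _ * X]gtr0_norm ?invr_gt0//.
  by rewrite ler_pdivrMr// mulrC.
(* With [t] fixed, replacing [f] by a far term [u m] costs only the additive error [a], which is
   arbitrary. *)
apply/ler_addgt0Pr => a a0.
have [M uM] := uf _ (divr_gt0 a0 (ltr0n _ 2)).
pose m := maxn M N.
have -> : (T t f p - f p) - (T t (u N) p - u N p) =
    (T t (fun q => u m q - u N q) p - (u m p - u N p)) +
    ((u m p - f p) - T t (fun q => u m q - f q) p).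
  by rewrite !semigroupB//; ring.
rewrite (le_trans (ler_normD _ _))// lerD//.
  apply: (@semigroup_increment_le _ (fun q => v m q - v N q)) => //.
  - exact: bounded_borelB.
  - exact: generator_limitB.
  - move=> q; have -> : v m q - v N q = (v m q - g q) - (v N q - g q) by ring.
    by rewrite (le_trans (ler_normB _ _))// lerD// vN// leq_maxr.
have um q : `|u m q - f q| <= a / 2 by rewrite uM// leq_maxl.
rewrite (splitr a) (le_trans (ler_normB _ _))// lerD//.
by apply: semigroup_contraction => //; exact: bounded_borelB.
Qed.

End Generator.

(** * The generator and completeness of its domain in the graph norm *)

Theorem proposition3p2 (R : realType) (K : riem_polyhedron R)
    (d : measure_display) (Om : measurableType d)
    (P : K -> probability Om R) (B : R -> Om -> one_point_compactification K) :
  admissible K -> brownian_motion P B ->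
  let D := generator_domain P B in
  exists L : (K -> R) -> (K -> R),
  [/\ forall f, D f -> bounded_borel (L f) /\ generator_limit P B f (L f),
      D (fun=> 0) /\
      (forall (a : R) f h, D f -> D h ->
         D (fun p => a * f p + h p) /\
         L (fun p => a * f p + h p) = (fun p => a * L f p + L h p)) &
      forall u : nat -> K -> R, (forall k, D (u k)) ->
        (forall e : R, 0 < e -> exists N : nat, forall k m : nat,
           (N <= k)%N -> (N <= m)%N ->
           graph_norm L (fun p => u k p - u m p) < e) ->
        exists2 f, D f &
          graph_norm L (fun p => u k p - f p) @[k --> \oo] --> (0 : R)].
Proof.
move=> _ [mB _ _ _ markovB] D.
(* On [D] the limit exists and is unique, so the choice is forced; where no limit exists, [L f] is
   zero by default. *)
pose L (f : K -> R) := xget (fun=> 0) [set g | generator_limit P B f g].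
have DL f : D f -> bounded_borel (L f) /\ generator_limit P B f (L f).
  move=> [bf [g fg]]; have fL : generator_limit P B f (L f) by apply: xgetPex; exists g.
  by split=> //; exact: (generator_limit_bounded_borel mB markovB bf).
have Dlin a f h : D f -> D h -> D (fun p => a * f p + h p) /\
    L (fun p => a * f p + h p) = (fun p => a * L f p + L h p).
  move=> Df Dh; have [[bf _] [bh _]] := (Df, Dh).
  have lim_ah := generator_limit_lin mB (a := a) bf bh (DL _ Df).2 (DL _ Dh).2.
  have Dah : D (fun p => a * f p + h p).
    by split; [exact: bounded_borel_lin|eexists; exact: lim_ah].
  by split=> //; exact: generator_limit_unique (DL _ Dah).2 lim_ah.
have DB f h : D f -> D h -> D (fun p => f p - h p) /\
    L (fun p => f p - h p) = (fun p => L f p - L h p).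
  move=> Df Dh; have [[bf _] [bh _]] := (Df, Dh).
  have lim_fh := generator_limitB mB bf bh (DL _ Df).2 (DL _ Dh).2.
  have Dfh : D (fun p => f p - h p).
    by split; [exact: bounded_borelB|eexists; exact: lim_fh].
  by split=> //; exact: generator_limit_unique (DL _ Dfh).2 lim_fh.
exists L; split=> //.
  split=> //; split; first exact: bounded_borel_cst.
  by exists (fun=> 0); exact: generator_limit_cst0.
move=> u Du cauchy_u.
(* The graph norm dominates both values pointwise, so [u k] and [L (u k)] are both uniformly
   Cauchy. *)
have graph_ge f p : D f -> `|f p| <= graph_norm L f /\ `|L f p| <= graph_norm L f.
  move=> Df; have [[bf _] [bL _]] := (Df, DL _ Df).
  rewrite /graph_norm; split.
    by rewrite (le_trans (sup_norm_ge p bf))// lerDl sup_norm_ge0.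
  by rewrite (le_trans (sup_norm_ge p bL))// lerDr sup_norm_ge0.
have [f uf] : exists f : K -> R, forall e, 0 < e ->
    exists N, forall k p, (N <= k)%N -> `|u k p - f p| <= e.
  apply: uniform_cauchy => e /cauchy_u[N NP]; exists N => k m p Nk Nm.
  rewrite (le_trans _ (ltW (NP _ _ Nk Nm)))//.
  by have [] := graph_ge _ p (DB _ _ (Du k) (Du m)).1.
have [g vg] : exists g : K -> R, forall e, 0 < e ->
    exists N, forall k p, (N <= k)%N -> `|L (u k) p - g p| <= e.
  apply: uniform_cauchy => e /cauchy_u[N NP]; exists N => k m p Nk Nm.
  rewrite (le_trans _ (ltW (NP _ _ Nk Nm)))//.
  have [DuB LuB] := DB _ _ (Du k) (Du m).
  by have [_] := graph_ge _ p DuB; rewrite LuB.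
have bf : bounded_borel f := bounded_borel_uniform (fun k => (Du k).1) uf.
(* Closedness puts the uniform limit [f] in the domain and identifies [L f] with [g]. *)
have fg : generator_limit P B f g.
  exact: (generator_closed mB markovB (fun k => (Du k).1) bf (fun k => (DL _ (Du k)).2) uf vg).
have Df : D f by split=> //; exists g.
have Lf : L f = g by exact: generator_limit_unique (DL _ Df).2 fg.
exists f => //; apply/cvgrPdist_le => e e0.
have e20 : 0 < e / 2 by rewrite divr_gt0.
have [[N uN] [M vM]] := (uf _ e20, vg _ e20).
exists (maxn N M) => // k /=; rewrite geq_max => /andP[Nk Mk].
have [[bu _] Lu] := DB _ _ (Du k) Df.
have bL := (DL _ (DB _ _ (Du k) Df).1).1.
rewrite sub0r normrN ger0_norm ?addr_ge0 ?sup_norm_ge0// (splitr e) lerD//.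
  by apply: sup_norm_le => [|p]; [exact: ltW|exact: uN].
by rewrite Lu; apply: sup_norm_le => [|p]; [exact: ltW|rewrite Lf; exact: vM].
Qed.
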